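(* Let $0<q<1$, $0<\theta<1$, let $r,k$ be positive integers, and let $W_{r,k}^{(III)}$ be the waiting time for the $r$-th overlapping success run of length $k$ in the $q$-geometric sequence of binary trials. For every integer $n\ge 0$, the probability mass function $w_q^{(III)}(n;r,k;\theta)=P_{q,\theta}\left(W_{r,k}^{(III)}=n\right)$ is given by $$P_{q,\theta}\left(W_{r,k}^{(III)}=n\right)=\begin{cases}\displaystyle\sum_{t=k}^{k+r-1}\ \sum_{i=\left[\frac{n-k-r}{k}\right]+1}^{n-k-r+1}\theta^{n-i}q^{it}\prod_{j=1}^{i}(1-\theta q^{j-1})\,C_q^k\bigl(i,\,n-t-i,\,r-C(t)\bigr), & \text{if } n>k+r-1,\\[2mm] \theta^{k+r-1}, & \text{if } n=k+r-1,\\ 0, & \text{if } n<k+r-1.\end{cases}$$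
   Context: The $q$-geometric sequence of binary trials: $X_1,X_2,\ldots$ take values in $\{0,1\}$ ($1$ = success, $0$ = failure). With $F_m=\sum_{j=1}^m(1-X_j)$ the number of failures in the first $m$ trials ($F_0=0$), conditionally on $X_1,\ldots,X_{j-1}$ with $F_{j-1}=i-1$, trial $j$ is a failure with probability $1-\theta q^{i-1}$ and a success with probability $\theta q^{i-1}$. $P_{q,\theta}$ denotes probability in this model. Overlapping (Type III) counting: a maximal block of $m\ge k$ consecutive successes (preceded and followed by a failure or by the beginning or end of the sequence) accounts for $m-k+1$ success runs of length $k$. Let $M_{n,k}$ be the total number of runs so counted in $X_1,\ldots,X_n$. $W_{r,k}^{(III)}=\min\{n:M_{n,k}\ge r\}$ is the number of trials until the $r$-th overlapping run occurs ($\infty$ if it never occurs). Put $C(j)=j-k+1$ if $j\ge k$ and $C(j)=0$ otherwise. For $0<q\le1$ and integers $m\ge1$, $s$, $t$, $$C_q^k(m,s,t)=\sum q^{\,y_2+2y_3+\cdots+(m-1)y_m},$$ the sum being over all integers $y_1,\ldots,y_m\ge0$ with $y_1+\cdots+y_m=s$ and $C(y_1)+\cdots+C(y_m)=t$. Empty sums are $0$. $[x]$ is the integer part of $x$. *)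

(* Defs.v *)
From HB Require Import structures.
From mathcomp Require Import all_boot all_order all_algebra.
From mathcomp Require Import all_classical all_reals all_analysis.

Set Implicit Arguments.
Unset Strict Implicit.
Unset Printing Implicit Defensive.

Import Order.TTheory GRing.Theory Num.Theory.

Local Open Scope ring_scope.
Local Open Scope classical_set_scope.

(* Trials are indexed from 0: [x j] is the outcome of trial number [j.+1] and
   [true] is a success. *)
Section runs.
Implicit Types (x : nat -> bool) (k m n r : nat).

Definition failures x m : nat := (\sum_(j < m) ~~ x j)%N.

(* The half-open interval [a, b) is a maximal block of successes among the first
   n trials. *)
Definition success_block x n a b : bool :=
  [&& (a < b)%N, (b <= n)%N, [forall j : 'I_n, (a <= j < b)%N ==> x j],
      (a == 0)%N || ~~ x a.-1 & (b == n) || ~~ x b].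

Definition run_count k m : nat := if (k <= m)%N then (m - k + 1)%N else 0%N.

Definition overlapping_runs k x n : nat :=
  (\sum_(a < n) \sum_(b < n.+1 | success_block x n a b) run_count k (b - a))%N.

(* [None] stands for an infinite waiting time. *)
Definition waiting_time r k x : option nat :=
  match pselect (exists n, (r <= overlapping_runs k x n)%N) with
  | left ex_n => Some (ex_minn ex_n)
  | right _ => None
  end.

End runs.

Section model.
Context d (T : measurableType d) (R : realType) (P : probability T R).

Definition cond_probability (A B : set T) : R :=
  fine (P (A `&` B)) / fine (P B).

Definition history (X : nat -> {RV P >-> bool}) (m : nat) (x : nat -> bool) :
  set T := [set w | forall j, (j < m)%N -> X j w = x j].

Definition q_geometric_trials (q theta : R) (X : nat -> {RV P >-> bool}) :
  Prop :=
  forall (m : nat) (x : nat -> bool), P (history X m x) != 0%E ->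
    cond_probability [set w | X m w = true] (history X m x)
      = theta * q ^+ failures x m /\
    cond_probability [set w | X m w = false] (history X m x)
      = 1 - theta * q ^+ failures x m.

End model.

(* A solution satisfies y_j <= s, so bounding each y_j by |s| discards no
   solution; y_(j+1) is [y j] here, whence the weight j * y j. *)
Definition C_q (R : realType) (q : R) (k m : nat) (s t : int) : R :=
  \sum_(y : {ffun 'I_m -> 'I_(`|s|%N.+1)} |
         ((\sum_(j < m) y j)%N%:Z == s)
         && ((\sum_(j < m) run_count k (y j))%N%:Z == t))
     q ^+ (\sum_(j < m) j * y j)%N.

(* Main.v *)
Require Import Defs.
From HB Require Import structures.
From mathcomp Require Import all_boot all_order all_algebra.
From mathcomp Require Import all_classical all_reals all_analysis.
From mathcomp Require Import zify ring.

Import Order.TTheory GRing.Theory Num.Theory.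
Local Open Scope ring_scope.
Local Open Scope classical_set_scope.

(** A run of length [k] is completed at trial [n] exactly when trials
    [n - k + 1, .., n] are all successes, so the overlapping count increases by
    one at such a trial and is constant otherwise ([overlapping_runsS]).  Hence
    the [r]-th run is completed at trial [n] if and only if the count at [n] is
    [r] and the success run ending at [n] has length at least [k]
    ([waiting_timeP]), an event that depends on the first [n] outcomes only.

    Its probability is therefore a finite sum over outcome strings, each string
    having the probability given by the chain rule ([probability_history],
    [probability_path_event]).  A string is the same thing as the lengths
    [y_1, .., y_i] of the possibly empty success runs that precede its [i]
    failures together with the length [t] of the final success run ([blocks]).
    The successes in the run [y_j] occur after [j - 1] failures, those of the
    final run after [i] failures, so that the string has probability
[[
    theta ^ (n - i) * q ^ (i * t) * \prod_(1 <= j <= i) (1 - theta q ^ (j - 1))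
      * q ^ (y_2 + 2 y_3 + .. + (i - 1) y_i)
]]
    ([path_prob_blocks]), and it contains [C(y_1) + .. + C(y_i) + C(t)] runs,
    where [C] is [run_count k].
    With [i] and [t] fixed, the last factor sums to a value of [C_q]
    ([sum_paths_C_q]); what remains is to find the possible pairs [(i, t)]
    ([hitting_bounds]).  For [n = k + r - 1] only the string without a failure
    is possible, and for smaller [n] there is none. *)

(** * Counting overlapping runs trial by trial *)

Fixpoint tail_run (x : nat -> bool) (n : nat) : nat :=
  if n is m.+1 then if x m then (tail_run x m).+1 else 0%N else 0%N.

Lemma tail_run_le x n : (tail_run x n <= n)%N.
Proof. by elim: n => //= n IHn; case: ifP. Qed.

Lemma leq_tail_runP (x : nat -> bool) n a : (a <= n)%N ->
  reflect (forall j, (a <= j < n)%N -> x j) (n - a <= tail_run x n)%N.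
Proof.
elim: n => [|n IHn] /= an.
  by rewrite sub0n; apply: ReflectT => j; lia.
have [->|ne] := eqVneq a n.+1.
  by rewrite subnn; apply: ReflectT => j; lia.
have {an ne}an : (a <= n)%N by lia.
rewrite subSn //; case: ifPn => xn.
  rewrite ltnS; apply: (iffP (IHn an)) => H j jn; last by apply: H; lia.
  by have [->//|ne] := eqVneq j n; apply: H; lia.
by apply: ReflectF => /(_ n); rewrite leqnn an (negbTE xn) => /(_ isT).
Qed.

(** A success block that ends at [b] is the success run ending there, so its
    left end is determined by [b]; this collapses the double sum over blocks. *)
Lemma success_blockE x n a b : success_block x n a b =
  [&& (a < b)%N, (b <= n)%N, (b - a == tail_run x b)%N & (b == n) || ~~ x b].
Proof.
rewrite /success_block; case: ltnP => //= ab; case: leqP => //= bn.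
rewrite andbA; congr (_ && _).
have -> : [forall j : 'I_n, (a <= j < b)%N ==> x j] =
    (b - a <= tail_run x b)%N.
  apply/forallP/(leq_tail_runP x b a (ltnW ab)) => [H j jab | H j].
    have jn : (j < n)%N by lia.
    by have /implyP := H (Ordinal jn); apply.
  by apply/implyP; apply: H.
case: a ab => [|a] ab /=; first by have := tail_run_le x b; lia.
rewrite eqn_leq; apply: andb_id2l => H1.
have H2 : (a <= b)%N by lia.
have -> : (tail_run x b <= b - a.+1)%N = ~~ (b - a <= tail_run x b)%N by lia.
congr negb; apply/idP/(leq_tail_runP x b a H2) => [xa j jab | H];
  last by apply: H; lia.
have [->//|ja] := eqVneq j a.
by have /(leq_tail_runP x b a.+1 (ltnW ab)) := H1; apply; lia.
Qed.

Lemma overlapping_runsE k x n : (0 < k)%N ->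
  overlapping_runs k x n =
  (\sum_(b < n.+1 | (b == n :> nat) || ~~ x b) run_count k (tail_run x b))%N.
Proof.
move=> k0; rewrite /overlapping_runs.
under eq_bigr => a _ do rewrite big_mkcond /=.
rewrite exchange_big [RHS]big_mkcond /=; apply: eq_bigr => b _.
rewrite -big_mkcond /=.
under eq_bigl => a do rewrite success_blockE.
have bn : (b <= n)%N by rewrite -ltnS.
case: ifP => C; last by rewrite big_pred0 // => a; rewrite !andbF.
have tb := tail_run_le x b.
(* An empty run is not a block; as [k] is positive, it also counts for zero. *)
have [t0|tpos] := posnP (tail_run x b).
  rewrite big_pred0; first by rewrite t0 /run_count leqNgt k0.
  by move=> a; rewrite t0; lia.
have an : (b - tail_run x b < n)%N by lia.
rewrite (big_pred1 (Ordinal an)) /=; first by rewrite subKn.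
move=> a; rewrite bn andbT /=.
by apply/idP/eqP => [H|-> /=]; first apply: val_inj => /=; lia.
Qed.

(** Passing from [n] to [n.+1] changes only the contribution of the last run: it
    stays if [x n] is a failure, and the run is lengthened by one
    otherwise. *)
Lemma overlapping_runsS k x n : (0 < k)%N ->
  overlapping_runs k x n.+1 =
  (overlapping_runs k x n + (k <= tail_run x n.+1))%N.
Proof.
move=> k0; rewrite !overlapping_runsE //.
rewrite big_mkcond big_ord_recr /= eqxx big_ord_recr /=.
rewrite [in RHS]big_mkcond big_ord_recr /= eqxx.
have -> : (n == n.+1) = false by lia.
have E i : (i < n)%N -> ((i == n.+1) = false) /\ ((i == n) = false) by lia.
under eq_bigr => i _ do rewrite (E _ (ltn_ord i)).1.
under [in RHS]eq_bigr => i _ do rewrite (E _ (ltn_ord i)).2.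
rewrite -!addnA; congr addn; rewrite /run_count.
by case: (x n) => /=; repeat case: ifP; lia.
Qed.

Lemma overlapping_runs0 k x : overlapping_runs k x 0 = 0%N.
Proof. by rewrite /overlapping_runs big_ord0. Qed.

(** Since the count grows by at most one per trial, it cannot jump over [r], and
    it reaches [r] at a trial that completes a run. *)
Lemma waiting_timeP r k x n : (0 < r)%N -> (0 < k)%N ->
  (waiting_time r k x = Some n) <->
  ((overlapping_runs k x n == r) && (k <= tail_run x n)%N).
Proof.
move=> r0 k0.
have mono m p : (m <= p)%N ->
    (overlapping_runs k x m <= overlapping_runs k x p)%N.
  move=> /subnK <-; elim: (p - m)%N => // i IHi.
  by rewrite addSn overlapping_runsS //; lia.
have first_hit : (waiting_time r k x = Some n) <->
    ((r <= overlapping_runs k x n)%N /\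
     forall m, (r <= overlapping_runs k x m)%N -> (n <= m)%N).
  rewrite /waiting_time; case: pselect => [ex|nex]; last first.
    by split=> // -[rn _]; case: nex; exists n.
  case: ex_minnP => m rm minm; split=> [[<-]//|[rn minn]].
  by congr Some; apply/eqP; rewrite eqn_leq minm ?minn.
rewrite {}first_hit; case: n => [|n].
  by rewrite overlapping_runs0; split; [case|]; lia.
rewrite overlapping_runsS //; split=> [[rn minn]|/andP[/eqP rn kn]].
  have : (overlapping_runs k x n < r)%N.
    by rewrite ltnNge; apply/negP => /minn; lia.
  by move: rn; case: (k <= _)%N; lia.
split=> [|m rm]; first by rewrite rn.
by rewrite ltnNge; apply/negP => /mono; lia.
Qed.

(** * Outcome strings as sequences of success runs *)

(** The lengths of the success runs preceding each failure among the first [n]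
    trials, in order of time, paired with the length of the final success
    run. *)
Fixpoint blocks (x : nat -> bool) (n : nat) : seq nat * nat :=
  if n is m.+1 then
    let: (ys, t) := blocks x m in
    if x m then (ys, t.+1) else (rcons ys t, 0%N)
  else ([::], 0%N).

Lemma blocks_total x n :
  (size (blocks x n).1 + sumn (blocks x n).1 + (blocks x n).2 = n)%N.
Proof.
elim: n => //= n; case: (blocks x n) => ys t /=; case: (x n) => /= IHn.
  by rewrite addnS IHn.
by rewrite size_rcons sumn_rcons; lia.
Qed.

Lemma blocks_tail x n : (blocks x n).2 = tail_run x n.
Proof.
by elim: n => //= n <-; case: (blocks x n) => ys t; case: (x n).
Qed.

Lemma blocks_size x n : size (blocks x n).1 = failures x n.
Proof.
elim: n => [|n] /=; first by rewrite /failures big_ord0.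
rewrite /failures big_ord_recr /= => <-.
case: (blocks x n) => ys t; case: (x n) => //=; first by rewrite addn0.
by rewrite size_rcons addn1.
Qed.

Lemma blocks_runs k x n : (0 < k)%N ->
  overlapping_runs k x n =
  (sumn (map (run_count k) (blocks x n).1) + run_count k (blocks x n).2)%N.
Proof.
move=> k0; have C0 : run_count k 0 = 0%N by rewrite /run_count leqNgt k0.
elim: n => [|n]; first by rewrite overlapping_runs0 /= C0.
rewrite overlapping_runsS // -blocks_tail /= => ->.
case: (blocks x n) => ys t; case: (x n) => /=.
  by rewrite -addnA; congr addn; rewrite /run_count; repeat case: ifP; lia.
by rewrite map_rcons sumn_rcons C0 leqNgt k0 !addn0.
Qed.

(** Together with [blocks_surj], this makes [blocks] a bijection between outcome
    strings of length [n] and the pairs allowed by [blocks_total]. *)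
Lemma blocks_inj x y n : blocks x n = blocks y n ->
  forall j, (j < n)%N -> x j = y j.
Proof.
elim: n => [//|n IHn] /=.
case Ex: (blocks x n) IHn => [xs s]; case Ey: (blocks y n) => [ys t] IHn.
have step : (xs, s) = (ys, t) -> x n = y n ->
    forall j, (j < n.+1)%N -> x j = y j.
  move=> e xyn j jn; have [->//|ne] := eqVneq j n.
  by apply: IHn => //; lia.
case xn: (x n) step; case yn: (y n) => step //= -[].
- by move=> e1 e2; apply: step => //; congr pair.
- by move=> /rcons_inj e; apply: step.
Qed.

Lemma eq_blocks x y n :
  (forall j, (j < n)%N -> x j = y j) -> blocks x n = blocks y n.
Proof.
elim: n => //= n IHn xy; rewrite xy // IHn // => j jn.
by apply: xy; lia.
Qed.

Lemma blocks_surj n ys t : (size ys + sumn ys + t = n)%N ->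
  exists x, blocks x n = (ys, t).
Proof.
elim: n ys t => [|n IHn] ys t.
  by case: ys => [|y ys] /=; [exists xpredT; congr pair|]; lia.
case: t => [|t].
  case/lastP: ys => [//|ys y]; rewrite size_rcons sumn_rcons => e.
  have [x xE] := IHn ys y ltac:(lia).
  exists (fun j => (j != n) && x j) => /=; rewrite eqxx /=.
  rewrite (@eq_blocks _ x) ?xE // => j jn.
  by rewrite neq_ltn jn.
move=> e; have [x xE] := IHn ys t ltac:(lia).
exists (fun j => (j == n) || x j) => /=; rewrite eqxx /=.
by rewrite (@eq_blocks _ x) ?xE // => j jn; rewrite ltn_eqF.
Qed.

Lemma blocks_tuple_surj n ys t : (size ys + sumn ys + t = n)%N ->
  exists s : n.-tuple bool, blocks (nth false s) n = (ys, t).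
Proof.
move=> /blocks_surj[x <-]; exists (mktuple (fun j : 'I_n => x j)).
apply: eq_blocks => j jn.
by rewrite -[j]/(nat_of_ord (Ordinal jn)) -tnth_nth tnth_mktuple.
Qed.

Lemma blocks_tuple_inj n :
  injective (fun s : n.-tuple bool => blocks (nth false s) n).
Proof.
move=> s s' /blocks_inj e; apply: val_inj; apply: (@eq_from_nth _ false).
  by rewrite !size_tuple.
by move=> j; rewrite size_tuple => /e.
Qed.

(** The exponent of [q] in [C_q]; the run at position [j] follows [j]
    failures. *)
Definition moment (ys : seq nat) : nat := (\sum_(j < size ys) j * nth 0 ys j)%N.

Lemma moment_rcons ys y : moment (rcons ys y) = (moment ys + size ys * y)%N.
Proof.
rewrite /moment size_rcons big_ord_recr /= nth_rcons ltnn eqxx.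
by congr addn; apply: eq_bigr => j _; rewrite nth_rcons ltn_ord.
Qed.

Section weight.
Context {R : realType} (q theta : R).

Definition trial_prob (b : bool) (f : nat) : R :=
  if b then theta * q ^+ f else 1 - theta * q ^+ f.

Definition path_prob (x : nat -> bool) (n : nat) : R :=
  \prod_(j < n) trial_prob (x j) (failures x j).

(** A success of the run at position [j] contributes [theta * q ^+ j], and the
    failure closing that run contributes [1 - theta * q ^+ j]. *)
Lemma path_prob_blocks x n : path_prob x n =
  theta ^+ (n - failures x n)
  * q ^+ (failures x n * tail_run x n)
  * (\prod_(1 <= j < (failures x n).+1) (1 - theta * q ^+ (j - 1)))
  * q ^+ moment (blocks x n).1.
Proof.
rewrite -blocks_tail -blocks_size.
have -> : (n - size (blocks x n).1 = sumn (blocks x n).1 + (blocks x n).2)%N.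
  by have := blocks_total x n; lia.
elim: n => [|n].
  by rewrite /path_prob big_ord0 /moment /= big_ord0 big_geq // !mulr1.
rewrite /path_prob big_ord_recr /= -blocks_size => ->.
case: (blocks x n) => ys t; case: (x n) => /=.
  by rewrite mulnS addnS exprS !exprD; ring.
rewrite size_rcons sumn_rcons moment_rcons muln0 addn0 expr0 mulr1.
by rewrite [in RHS]big_nat_recr //= subSS subn0 !exprD; ring.
Qed.

(** [C_q] sums over bounded finite functions, [blocks] produces sequences; this
    injection and its range [seq_of_ffun_surj] translate between the two. *)
Definition seq_of_ffun {m N} (y : {ffun 'I_m -> 'I_N}) : seq nat :=
  codom (fun j => nat_of_ord (y j)).

Lemma size_seq_of_ffun {m N} (y : {ffun 'I_m -> 'I_N}) :
  size (seq_of_ffun y) = m.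
Proof. by rewrite size_codom card_ord. Qed.

Lemma nth_seq_of_ffun {m N} (y : {ffun 'I_m -> 'I_N}) (j : 'I_m) :
  nth 0%N (seq_of_ffun y) j = y j.
Proof.
by rewrite /seq_of_ffun codomE (nth_map j) ?size_enum_ord // nth_ord_enum.
Qed.

Lemma seq_of_ffun_inj m N : injective (@seq_of_ffun m N).
Proof.
move=> y z e; apply/ffunP => j; apply: val_inj => /=.
by rewrite -!nth_seq_of_ffun e.
Qed.

Lemma sumn_map_seq_of_ffun m N (f : nat -> nat) (y : {ffun 'I_m -> 'I_N}) :
  sumn (map f (seq_of_ffun y)) = (\sum_(j < m) f (y j))%N.
Proof. by rewrite sumnE big_map /seq_of_ffun codomE big_map big_enum. Qed.

Lemma moment_seq_of_ffun {m N} (y : {ffun 'I_m -> 'I_N}) :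
  moment (seq_of_ffun y) = (\sum_(j < m) j * y j)%N.
Proof.
rewrite /moment size_seq_of_ffun.
by apply: eq_bigr => j _; rewrite nth_seq_of_ffun.
Qed.

Lemma seq_of_ffun_surj m N ys : size ys = m -> all (fun y => y < N)%N ys ->
  exists y : {ffun 'I_m -> 'I_N}, seq_of_ffun y = ys.
Proof.
move=> <- /all_nthP ysN.
exists [ffun j : 'I_(size ys) => Ordinal (ysN 0%N j (ltn_ord j))].
apply: (@eq_from_nth _ 0%N); first by rewrite size_seq_of_ffun.
move=> j; rewrite size_seq_of_ffun => jm.
by rewrite (nth_seq_of_ffun _ (Ordinal jm)) ffunE.
Qed.

Lemma leq_mem_sumn (ys : seq nat) y : y \in ys -> (y <= sumn ys)%N.
Proof.
by elim: ys => //= z ys IHys; rewrite inE => /predU1P[->|/IHys]; lia.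
Qed.

(** Strings with a given final run and number of failures correspond to the run
    lengths [y] allowed in [C_q]: the total length [n] fixes the sum of [y], and
    the total count [r] fixes the sum of the counts of [y]. *)
Lemma sum_paths_C_q (k n r i t : nat) : (0 < k)%N ->
  \sum_(s : n.-tuple bool | [&& overlapping_runs k (nth false s) n == r,
        tail_run (nth false s) n == t & failures (nth false s) n == i])
     q ^+ moment (blocks (nth false s) n).1 =
  C_q q k i (n%:Z - t%:Z - i%:Z) (r%:Z - (run_count k t)%:Z).
Proof.
move=> k0; rewrite /C_q.
set N := (`|_|.+1)%N.
pose Q (s : n.-tuple bool) := let b := blocks (nth false s) n in
  [&& (sumn (map (run_count k) b.1) + run_count k b.2 == r)%N,
      b.2 == t & size b.1 == i].
pose P (y : {ffun 'I_i -> 'I_N}) := let ys := seq_of_ffun y in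
  ((sumn ys)%:Z == n%:Z - t%:Z - i%:Z) &&
  ((sumn (map (run_count k) ys))%:Z == r%:Z - (run_count k t)%:Z).
rewrite (eq_bigl (mem Q)); last first.
  by move=> s; rewrite /= unfold_in /Q blocks_runs // -blocks_tail -blocks_size.
rewrite [RHS](eq_bigl (mem P)); last first.
  move=> y; rewrite /= unfold_in /P /=.
  rewrite -[in sumn (seq_of_ffun y)](map_id (seq_of_ffun y)).
  by rewrite !sumn_map_seq_of_ffun.
under [RHS]eq_bigr => y _ do rewrite -moment_seq_of_ffun.
rewrite -(big_image _ _ (fun s : n.-tuple bool => (blocks (nth false s) n).1)
  Q (fun ys => q ^+ moment ys)).
rewrite -(big_image _ _ seq_of_ffun P (fun ys => q ^+ moment ys)).
apply: perm_big; apply: uniq_perm.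
- apply/dinjectiveP => s s'; rewrite !unfold_in.
  case/and3P=> _ /eqP st _ /and3P[_ /eqP s't _] e.
  apply: blocks_tuple_inj; rewrite (surjective_pairing (blocks _ _)) e st -s't.
  by rewrite -surjective_pairing.
- by apply/dinjectiveP => y z _ _; apply: seq_of_ffun_inj.
move=> ys; apply/fintype.imageP/fintype.imageP => -[].
  move=> s; rewrite unfold_in /Q.
  have := blocks_total (nth false s) n.
  case: (blocks _ n) => {}ys t' /= tot /and3P[/eqP Cr /eqP tt' /eqP si] ->.
  (* No entry exceeds the sum of all entries, which is the bound [N.-1]. *)
  have : all (fun y => y < N)%N ys.
    by apply/allP => y /leq_mem_sumn; rewrite /N; lia.
  move=> /(seq_of_ffun_surj _ _ _ si)[y ysE]; exists y => //.
  rewrite unfold_in /P /= ysE; apply/andP; split; apply/eqP; first by lia.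
  by rewrite -Cr tt' PoszD addrK.
move=> y; rewrite unfold_in => /andP[/eqP e1 /eqP e2] ->.
have [|s sE] := @blocks_tuple_surj n (seq_of_ffun y) t.
  by rewrite size_seq_of_ffun; lia.
exists s; last by rewrite sE.
rewrite unfold_in /Q sE /= size_seq_of_ffun !eqxx !andbT.
by rewrite -eqz_nat PoszD e2 subrK.
Qed.

Lemma sumn_run_count_le k ys : (0 < k)%N ->
  (sumn (map (run_count k) ys) <= sumn ys)%N.
Proof.
by move=> k0; elim: ys => //= y ys; rewrite {2}/run_count; case: ifP; lia.
Qed.

(** A run of length [y] satisfies [y <= run_count k y + (k - 1)]. *)
Lemma sumn_le_run_count k ys : (0 < k)%N ->
  (sumn ys + size ys <= sumn (map (run_count k) ys) + size ys * k)%N.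
Proof.
move=> k0; elim: ys => //= y ys; rewrite {2}/run_count mulSn.
by case: (leqP k y); lia.
Qed.

(** The ranges of the two summations.  The number [r] of runs is at least the
    count of the final run, which bounds its length.  Every [y] satisfies
    [run_count k y <= y <= run_count k y + (k - 1)]; summed over the runs before
    the failures, the lower bound on [y] limits the number of failures from
    above and the upper bound on [y] limits it from below. *)
Lemma hitting_bounds k r x n : (0 < k)%N -> (0 < r)%N ->
  overlapping_runs k x n == r -> (k <= tail_run x n)%N ->
  [/\ (k <= tail_run x n < k + r)%N,
      (failures x n + (k + r) <= n.+1)%N &
      (n < failures x n * k + (k + r))%N].
Proof.
move=> k0 r0; rewrite blocks_runs // -blocks_tail -blocks_size.
move: (blocks_total x n); case: (blocks x n) => ys t /= tot /eqP C kt.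
have := sumn_run_count_le k ys k0; have := sumn_le_run_count k ys k0.
by move: C; rewrite {2}/run_count kt => *; split; lia.
Qed.

(** Inserting the indicators of the values of the final run length and of the
    number of failures, and exchanging summations, classifies the strings by
    these two numbers. *)
Lemma sum_hitting_paths k r n : (0 < k)%N -> (0 < r)%N ->
  \sum_(s : n.-tuple bool | (overlapping_runs k (nth false s) n == r)
        && (k <= tail_run (nth false s) n)%N) path_prob (nth false s) n =
  if (k + r - 1 < n)%N then
     \sum_(k <= t < (k + r - 1).+1)
       \sum_(((n - k - r) %/ k + 1)%N <= i < (n - k - r + 1).+1)
         theta ^+ (n - i) * q ^+ (i * t)
         * (\prod_(1 <= j < i.+1) (1 - theta * q ^+ (j - 1)))
         * C_q q k i (n%:Z - t%:Z - i%:Z) (r%:Z - (run_count k t)%:Z)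
   else if n == (k + r - 1)%N then theta ^+ (k + r - 1)
   else 0.
Proof.
move=> k0 r0; case: ltnP => n_big; last case: eqP => n_eq.
- under [RHS]eq_big_nat => t kt.
    under eq_bigr => i _.
      rewrite -sum_paths_C_q // big_distrr.
      rewrite (eq_bigl (fun s : n.-tuple bool =>
        ((overlapping_runs k (nth false s) n == r)
          && (k <= tail_run (nth false s) n)%N)
        && ((t == tail_run (nth false s) n)
            && (i == failures (nth false s) n)))); last first.
        by move=> s; rewrite [t == _]eq_sym [i == _]eq_sym; lia.
      rewrite big_mkcondr.
      over.
    rewrite exchange_big.
    over.
  rewrite exchange_big; apply: eq_bigr => s /andP[hs ks] /=.
  have [tb ib ib'] := hitting_bounds _ _ _ _ k0 r0 hs ks.
  set x := nth false s in hs ks tb ib ib' *.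
  under eq_bigr => t _.
    under eq_bigr => i _ do rewrite andbC if_and.
    rewrite -big_mkcond big_nat1_eq.
    rewrite (_ : (_ <= failures x n < _)%N = true); last first.
      by rewrite addn1 ltn_divLR //; lia.
    over.
  rewrite -big_mkcond big_nat1_eq.
  rewrite (_ : (_ <= tail_run x n < _)%N = true); last by lia.
  exact: path_prob_blocks.
(* Here the bounds force the number of failures to be zero, so that the string
   of [n] successes is the only one left. *)
- have [|s0 s0E] := @blocks_tuple_surj n [::] n; first by [].
  have s0t : tail_run (nth false s0) n = n by rewrite -blocks_tail s0E.
  have s0f : failures (nth false s0) n = 0%N by rewrite -blocks_size s0E.
  rewrite (big_pred1 s0) => [|s].
    rewrite path_prob_blocks s0t s0f s0E /= big_geq // /moment big_ord0 mul0n.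
    by rewrite !mulr1 subn0 n_eq.
  apply/andP/eqP => [[hs ks]|->]; last first.
    have kn : (k <= n)%N by lia.
    by rewrite blocks_runs // s0t s0E /= /run_count kn; split=> //; lia.
  apply: blocks_tuple_inj; rewrite s0E; move: hs ks.
  set x := nth false s => hs ks.
  have [tb ib ib'] := hitting_bounds _ _ _ _ k0 r0 hs ks.
  have : size (blocks x n).1 = 0%N by rewrite blocks_size; lia.
  have := blocks_total x n.
  by case: (blocks _ _) => [[|y ys] t] //= e _; congr pair; lia.
rewrite big_pred0 // => s; apply/negP => /andP[hs ks].
have [tb ib ib'] := hitting_bounds _ _ _ _ k0 r0 hs ks.
by lia.
Qed.

End weight.

(** * Probabilities of outcome strings *)

(** Strict positivity makes every history non-null, so that the conditional
    probabilities of the model are prescribed after each of them. *)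
Lemma trial_prob_gt0 (R : realType) (q theta : R) b f :
  0 < q < 1 -> 0 < theta < 1 -> 0 < trial_prob q theta b f.
Proof.
move=> /andP[q0 q1] /andP[t0 t1]; rewrite /trial_prob.
case: b; first by rewrite mulr_gt0 ?exprn_gt0.
rewrite subr_gt0 (le_lt_trans _ t1) // ler_piMr ?(ltW t0) //.
by rewrite exprn_ile1 ?(ltW q0) ?(ltW q1).
Qed.

Section trials.
Context {R : realType} {d : measure_display} {T : measurableType d}
  {P : probability T R} (q theta : R) (X : nat -> {RV P >-> bool}).

Lemma measurable_trial j b : measurable [set w | X j w = b].
Proof.
rewrite (_ : [set w | _] = X j @^-1` [set b]) //.
exact: measurable_funPTI.
Qed.

Lemma historyS n x :
  history X n.+1 x = [set w | X n w = x n] `&` history X n x.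
Proof.
apply/seteqP; split=> [w /= H|w [/= xn H]].
  by split=> [|j jn]; apply: H => //; apply: ltnW.
by move=> j; rewrite ltnS leq_eqVlt => /predU1P[->//|]; apply: H.
Qed.

Lemma history0 x : history X 0 x = setT.
Proof. by apply/seteqP; split=> w //= _ j; rewrite ltn0. Qed.

Lemma measurable_history n x : measurable (history X n x).
Proof.
elim: n => [|n IHn]; first by rewrite history0.
by rewrite historyS; apply: measurableI => //; apply: measurable_trial.
Qed.

(** The chain rule for conditional probabilities. *)
Lemma probability_history n x :
  0 < q < 1 -> 0 < theta < 1 -> q_geometric_trials q theta X ->
  P (history X n x) = (path_prob q theta x n)%:E.
Proof.
move=> hq htheta hX; elim: n => [|n IHn].
  by rewrite history0 probability_setT /path_prob big_ord0.
have pos : 0 < path_prob q theta x n.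
  by apply: prodr_gt0 => j _; apply: trial_prob_gt0.
have [|success failure] := hX n x.
  by rewrite IHn eqe gt_eqF.
have : cond_probability P [set w | X n w = x n] (history X n x)
    = trial_prob q theta (x n) (failures x n) by case: (x n).
rewrite /cond_probability -historyS IHn /= => /(canRL (divfK (lt0r_neq0 pos))).
rewrite /path_prob big_ord_recr /= mulrC => <-.
by rewrite fineK // fin_num_measure //; apply: measurable_history.
Qed.

(** An event decided by the first [n] trials is the disjoint union of the
    histories that it contains. *)
Lemma probability_path_event n (A : (nat -> bool) -> bool) :
  0 < q < 1 -> 0 < theta < 1 -> q_geometric_trials q theta X ->
  (forall x y, (forall j, (j < n)%N -> x j = y j) -> A x = A y) ->
  P [set w | A (fun j => X j w)] =
  (\sum_(s : n.-tuple bool | A (nth false s))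
     path_prob q theta (nth false s) n)%:E.
Proof.
move=> hq htheta hX A_local.
pose paths := [seq s : n.-tuple bool <- index_enum _ | A (nth false s)].
have pathsE (s : n.-tuple bool) : (s \in paths) = A (nth false s).
  by rewrite mem_filter mem_index_enum andbT.
have -> : [set w | A (fun j => X j w)] =
    \bigcup_(s in [set` paths]) history X n (nth false s).
  apply/seteqP; split=> w /=.
    move=> Aw; pose s := [tuple X j w | j < n].
    have sE j : (j < n)%N -> X j w = nth false s j.
      move=> jn; rewrite -[j]/(nat_of_ord (Ordinal jn)) -tnth_nth.
      by rewrite tnth_mktuple.
    by exists s => //=; rewrite pathsE -(A_local _ _ sE).
  by case=> s /=; rewrite pathsE => As sE; rewrite (A_local _ _ sE).
rewrite measure_fin_bigcup //.
- rewrite -fsbig_seq ?filter_uniq ?index_enum_uniq // big_filter -sumEFin.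
  by apply: eq_bigr => s _; apply: probability_history.
- move=> s s' _ _ [w [/= sE s'E]]; apply: val_inj.
  apply: (@eq_from_nth _ false); first by rewrite !size_tuple.
  by move=> j; rewrite size_tuple => jn; rewrite -sE // s'E.
- by move=> s _; apply: measurable_history.
Qed.

End trials.

Theorem theorem5p1 (R : realType) (d : measure_display) (T : measurableType d)
    (P : probability T R) (q theta : R) (X : nat -> {RV P >-> bool})
    (r k n : nat)
    (hq : 0 < q < 1) (htheta : 0 < theta < 1) (hr : (0 < r)%N) (hk : (0 < k)%N)
    (hX : q_geometric_trials q theta X) :
  P [set w | waiting_time r k (fun j => X j w) = Some n] =
  (if (k + r - 1 < n)%N then
     \sum_(k <= t < (k + r - 1).+1)
       \sum_(((n - k - r) %/ k + 1)%N <= i < (n - k - r + 1).+1)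
         theta ^+ (n - i) * q ^+ (i * t)
         * (\prod_(1 <= j < i.+1) (1 - theta * q ^+ (j - 1)))
         * C_q q k i (n%:Z - t%:Z - i%:Z) (r%:Z - (run_count k t)%:Z)
   else if n == (k + r - 1)%N then theta ^+ (k + r - 1)
   else 0)%:E.
Proof.
rewrite -sum_hitting_paths //.
rewrite -(@probability_path_event _ _ _ _ _ _ X n (fun x =>
  (overlapping_runs k x n == r) && (k <= tail_run x n)%N)) //.
  by congr (P _); apply/seteqP; split=> w /= /waiting_timeP; apply.
by move=> x y /eq_blocks xy; rewrite !blocks_runs // -!blocks_tail xy.
Qed.
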